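(* Let $\epsilon>0$ be fixed and let $C>0$ satisfy $\displaystyle C\,\frac{\epsilon^2}{4\bigl(1+(1+\epsilon)^2\bigr)}>1$. For each $n$, let $p=p_n=C\frac{\log n}{n}$ and let $\mathbf{D}$ be a random directed graph on $\{1,\dots,n\}$ in which each of the $n(n-1)$ possible arcs $(i,j)$, $i\ne j$, is present independently with probability $p$; let $\mathbf{X}^*$ be the number of feedforward arcs and $\mathbf{Y}^*$ the number of feedback arcs in an FAS solution of $\mathbf{D}$. Then $$\lim_{n\to\infty}\Pr\left(\frac{\mathbf{X}^*}{\mathbf{Y}^*}\ge 1+\epsilon\right)=0.$$
   Context: Here $\log$ is the natural logarithm. For a digraph with vertices numbered $1,\dots,n$, an arc from $i$ to $j$ is called feedforward if $j>i$ and feedback if $j<i$. An FAS solution is a renumbering (permutation) of the vertices that minimizes the number of feedback arcs; $\mathbf{Y}^*$ is this minimal number and $\mathbf{X}^*$ is the number of feedforward arcs in such a renumbering (total number of arcs minus $\mathbf{Y}^*$). By convention, $\frac{X}{Y}\ge r$ is defined to be true when $Y=0$. *)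

(* Defs.v *)
From HB Require Import structures.
From mathcomp Require Import all_boot all_order all_algebra all_fingroup.
From mathcomp Require Import all_classical all_reals all_analysis.
Import Order.TTheory GRing.Theory Num.Theory.
Import numFieldNormedType.Exports.

Set Implicit Arguments.
Unset Strict Implicit.
Unset Printing Implicit Defensive.

Local Open Scope classical_set_scope.
Local Open Scope ring_scope.

(* The vertices 1, ..., n are represented by 'I_n = {0, ..., n-1}. *)
Notation arc n := {a : 'I_n * 'I_n | a.1 != a.2}.
Notation digraph n := {set arc n}.

Section FAS.
Variable n : nat.
Implicit Types (D : digraph n) (s : 'S_n).

(* The permutation s gives vertex i the new number s i. *)
Definition feedforward D s : nat :=
  #|[pred a in D | (s (val a).1 < s (val a).2)%N]|.

Definition feedback D s : nat :=
  #|[pred a in D | (s (val a).2 < s (val a).1)%N]|.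

Definition is_fas D s : Prop := forall t, (feedback D s <= feedback D t)%N.

Definition fas D : 'S_n := [arg min_(s < 1%g) feedback D s]%N.

Definition Xstar D : nat := feedforward D (fas D).
Definition Ystar D : nat := feedback D (fas D).

Lemma feedforwardD D s : (feedforward D s + feedback D s)%N = #|D|.
Proof.
rewrite -(cardID [pred a : arc n | (s (val a).1 < s (val a).2)%N] (mem D)).
congr addn; apply: eq_card => a.
have ne : s (val a).1 != s (val a).2 :> nat.
  by rewrite (inj_eq val_inj) (inj_eq perm_inj) (valP a).
by rewrite !inE andbC; case: ltngtP ne.
Qed.

Lemma fasP D : is_fas D (fas D).
Proof. by rewrite /fas; case: arg_minnP => // s _ sP t; exact: sP. Qed.

Lemma is_fas_feedback D s : is_fas D s -> feedback D s = Ystar D.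
Proof. by move=> sP; apply/eqP; rewrite eqn_leq sP fasP. Qed.

(* Xstar and Ystar do not depend on the choice of FAS solution. *)
Lemma is_fas_feedforward D s : is_fas D s -> feedforward D s = Xstar D.
Proof.
move=> sP; apply/eqP; rewrite -(eqn_add2r (Ystar D)) /Xstar feedforwardD.
by rewrite -(is_fas_feedback sP) feedforwardD.
Qed.

End FAS.

(* X / Y >= r, true by convention when Y = 0. *)
Definition ratio_ge (R : realType) (X Y : nat) (r : R) : bool :=
  (Y == 0)%N || (r <= X%:R / Y%:R).

Definition mutually_independent d (T : measurableType d) (R : realType)
    (P : probability T R) (I : finType) (E : I -> set T) : Prop :=
  forall A : {set I},
    P (\bigcap_(i in [set` A]) E i) = (\prod_(i in A) P (E i))%E.

Definition arc_event (T : Type) n (D : T -> digraph n) (a : arc n) : set T :=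
  [set w | a \in D w].

Definition random_digraph d (T : measurableType d) (R : realType)
    (P : probability T R) n (p : R) (D : T -> digraph n) : Prop :=
  [/\ forall a, measurable (arc_event D a),
      mutually_independent P (arc_event D)
    & forall a, P (arc_event D a) = p%:E].

Definition arc_prob (R : realType) (C : R) (n : nat) : R :=
  C * (ln n%:R / n%:R).

(* Main.v *)
(** Put r = 1 + eps.  If X^* / Y^* >= r, then 0 <= X_s - r Y_s for the optimal
renumbering s, where X_s and Y_s count the feedforward and feedback arcs of s.
For a fixed s, each of X_s and Y_s counts n(n-1)/2 potential arcs, so Chernoff's
bound reads
  Pr (X_s - r Y_s >= 0) <= exp (p (n(n-1)/2) (e^t + e^(-rt) - 2)).
At t = eps / (1 + r^2), the minimizer of the quadratic Taylor polynomial of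
e^t + e^(-rt) - 2, the bracket is at most -eps^2 / (2 (1 + r^2)), because on
[0, t] its second derivative never exceeds the value 1 + r^2 taken at 0.  With
p = C log n / n, a union bound over the at most n^n renumberings leaves
exp (log n (n - k (n - 1))) with k = C eps^2 / (4 (1 + r^2)) > 1. *)

Require Import Defs.
From HB Require Import structures.
From mathcomp Require Import all_boot all_order all_algebra all_fingroup.
From mathcomp Require Import all_classical all_reals all_analysis.
From mathcomp Require Import ring lra.
Import Order.TTheory GRing.Theory Num.Theory.
Import numFieldNormedType.Exports.

Set Implicit Arguments.
Unset Strict Implicit.
Unset Printing Implicit Defensive.

Local Open Scope classical_set_scope.
Local Open Scope ring_scope.

(** * Law of a random digraph *)

Definition law d (T : measurableType d) (R : realType) (P : probability T R)
  (U : finType) (f : T -> U) (u : U) : R := fine (P (f @^-1` [set u])).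

Lemma law_ge0 d (T : measurableType d) (R : realType) (P : probability T R)
  (U : finType) (f : T -> U) (u : U) : 0 <= law P f u.
Proof. by rewrite fine_ge0. Qed.

Lemma probability_law d (T : measurableType d) (R : realType)
    (P : probability T R) (U : finType) (f : T -> U) (S : pred U) :
  (forall u, measurable (f @^-1` [set u])) ->
  P [set w | S (f w)] = (\sum_(u | S u) law P f u)%:E.
Proof.
move=> mf.
have -> : [set w | S (f w)] = \bigcup_(u in [set` S]) (f @^-1` [set u]).
  apply/seteqP; split=> [w Sw|w [u Su /= fwu]] /=; last by rewrite fwu.
  by exists (f w).
rewrite measure_fin_bigcup//.
- rewrite -sumEFin.
  rewrite (_ : [set` S] = [set` enum S]); last first.
    by apply/seteqP; split=> u /=; rewrite mem_enum.
  rewrite -fsbig_seq ?enum_uniq// big_enum/=; apply: eq_bigr => u _.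
  by rewrite fineK// fin_num_measure.
- by move=> u v _ _ [w [/= <- <-]].
Qed.

Lemma measurable_random_digraph d (T : measurableType d) n
    (D : T -> digraph n) (G : digraph n) :
  (forall a, measurable (arc_event D a)) -> measurable (D @^-1` [set G]).
Proof.
move=> mD.
have -> : D @^-1` [set G] =
    \bigcap_(a in setT)
      (if a \in G then arc_event D a else ~` arc_event D a).
  apply/seteqP; split=> [w /= <- a _|w /= H].
    by rewrite /arc_event; case: ifP => //= ->.
  apply/setP => a; have := H a I; rewrite /arc_event.
  by case: ifP => [_ ->//|_ /= /negP/negbTE].
apply: fin_bigcap_measurable => // a _; case: ifP => _ //.
exact: measurableC.
Qed.

(** The sum is the probability that all arcs of [A] are present, an intersection of independent arc
    events. This supplies the hypothesis of [sum_prod_superset]. *)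
Lemma sum_law_superset d (T : measurableType d) (R : realType)
    (P : probability T R) n (p : R) (D : T -> digraph n) (A : digraph n) :
  random_digraph P p D ->
  \sum_(G : digraph n | A \subset G) law P D G = p ^+ #|A|.
Proof.
move=> [mD iD pD]; apply: EFin_inj.
rewrite -(probability_law P (fun G : {set _} => A \subset G)) => [|G];
  last first.
  exact: measurable_random_digraph.
have := iD A; rewrite (eq_bigr (fun=> p%:E))//.
rewrite prodEFin prodr_const => <-; congr (P _).
apply/seteqP; split=> [w /= /fintype.subsetP AD a|w /= H]; first exact: AD.
by apply/fintype.subsetP => a; exact: H.
Qed.

(* If mu is the law of a random set G in which each a lies independently with
   probability p, this computes the expectation of a product over G; expanding
   the product needs independence only for events of the form A \subset G. *)
Lemma sum_prod_superset (R : comNzRingType) (I : finType) (p : R)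
    (mu : {set I} -> R) (u : I -> R) :
  (forall A : {set I}, \sum_(G : {set I} | A \subset G) mu G = p ^+ #|A|) ->
  \sum_(G : {set I}) mu G * \prod_(a in G) (1 + u a) = \prod_a (1 + p * u a).
Proof.
move=> muE.
have prodE (A : {set I}) (F : I -> R) :
    \prod_(a in A) F a = \prod_a if a \in A then F a else 1.
  by rewrite big_mkcond.
have E (G : {set I}) : \prod_(a in G) (1 + u a) =
    \sum_(A : {set I} | A \subset G) \prod_(a in A) u a.
  (* Extending the product to all [a] lets the expansion range over every [A]; a zero factor kills
     each [A] not inside [G]. *)
  rewrite prodE (eq_bigr (fun a => (if a \in G then u a else 0) + 1)) => [|a _].
    rewrite bigA_distr [RHS]big_mkcond/=; apply: eq_bigr => A _.
    rewrite -prodE.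
    case: ifPn => [/fintype.subsetP AG|/subsetPn[a aA /negbTE aG]].
      by apply: eq_bigr => a /AG ->.
    by rewrite (bigD1 a)//= aG mul0r.
  by case: ifP => _; rewrite ?add0r// addrC.
under [LHS]eq_bigr do rewrite E big_distrr/=.
rewrite (exchange_big_dep xpredT)//=.
under [LHS]eq_bigr do rewrite -big_distrl/= muE.
under [RHS]eq_bigr do rewrite addrC.
rewrite bigA_distr; apply: eq_bigr => A _.
by rewrite -prodE big_split/= prodr_const.
Qed.

(** * Quadratic bound for a sum of exponentials *)

Lemma is_derive_le0_le (R : realType) (f df : R -> R) (a : R) :
  0 <= a -> (forall x : R, is_derive x 1 f (df x)) ->
  (forall x, 0 < x < a -> df x <= 0) -> f a <= f 0.
Proof.
move=> a0 dfP dfle; have fd x : derivable f x 1 by have [] := dfP x.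
apply: (@ler0_derive1_le_cc _ f 0 a) => //; rewrite ?in_itv /= ?lexx ?a0 //.
- move=> x; rewrite in_itv /= => xa; rewrite derive1E.
  by have [_ ->] := dfP x; exact: dfle.
- apply: continuous_subspaceT => x.
  by apply: differentiable_continuous; exact/derivable1_diffP.
Qed.

(** Bound the second derivative by 1 + r^2 on (0, a), then integrate twice from 0. Since e^x <=
    1/(1-x) and e^(-rx) <= 1/(1+rx), its excess over 1 + r^2 is at most x/(1-x) - r^3 x/(1+rx),
    which the last hypothesis makes nonpositive. *)
Lemma expR_quadratic_bound (R : realType) (r a : R) :
  1 <= r -> 0 <= a -> 1 + r * a <= r ^+ 3 * (1 - a) ->
  expR a + expR (- (r * a)) - 2 <= (1 - r) * a + (1 + r ^+ 2) / 2 * a ^+ 2.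
Proof.
move=> r1 a0 ra.
have d2 x : 0 < x < a -> expR x + r ^+ 2 * expR (- (r * x)) - (1 + r ^+ 2) <= 0.
  move=> /andP[x0 xa].
  have rx0 : 0 < r * x by rewrite mulr_gt0// (lt_le_trans _ r1).
  (* The hypothesis [ra] forces a < 1. *)
  have x1 : 0 < 1 - x.
    have := exprn_gt0 3 (lt_le_trans ltr01 r1); nra.
  have hE : expR x * (1 - x) <= 1.
    by rewrite -[leRHS](expRxMexpNx_1 x) ler_wpM2l ?expR_ge0// expR_ge1Dx.
  have hF : expR (- (r * x)) * (1 + r * x) <= 1.
    rewrite -[leRHS](expRxMexpNx_1 (r * x)) mulrC ler_wpM2r ?expR_ge0//.
    exact: expR_ge1Dx.
  have hx : 1 + r * x <= r ^+ 3 * (1 - x).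
    apply: (le_trans (y := 1 + r * a)); first by rewrite lerD2l ler_wpM2l; lra.
    apply: (le_trans ra); rewrite ler_wpM2l ?exprn_ge0//; lra.
  have q0 : 0 < (1 - x) * (1 + r * x) by rewrite mulr_gt0// addr_gt0.
  (* Clearing the positive denominators leaves a linear combination of [h1], [h2] and [h3]. *)
  rewrite -(pmulr_rle0 _ q0).
  have h1 : (1 + r * x) * (expR x * (1 - x)) <= (1 + r * x) * 1.
    by rewrite ler_wpM2l// ltW// addr_gt0.
  have h2 : r ^+ 2 * ((1 - x) * (expR (- (r * x)) * (1 + r * x)))
      <= r ^+ 2 * ((1 - x) * 1).
    by rewrite ler_wpM2l ?sqr_ge0// ler_wpM2l// ltW.
  have h3 : x * (1 + r * x) <= x * (r ^+ 3 * (1 - x)).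
    by rewrite ler_wpM2l// ltW.
  lra.
(* [f1] is the derivative of [f] below, and both vanish at 0. *)
pose f1 y := expR y - r * expR (- (r * y)) - (1 - r) - (1 + r ^+ 2) * y.
have d1 x : 0 < x < a -> f1 x <= 0.
  move=> /andP[x0 xa].
  suff : f1 x <= f1 0 by rewrite /f1 !(mulr0, oppr0, expR0); lra.
  apply: (is_derive_le0_le (df := fun y =>
    expR y + r ^+ 2 * expR (- (r * y)) - (1 + r ^+ 2))) (ltW x0) _ _.
    by move=> y; apply: is_derive_eq; rewrite /GRing.scale/=; ring.
  by move=> y /andP[y0 yx]; apply: d2; rewrite y0 (lt_trans yx).
pose f y := expR y + expR (- (r * y)) - 2 - (1 - r) * y
  - (1 + r ^+ 2) / 2 * y ^+ 2.
suff : f a <= f 0 by rewrite /f !(mulr0, oppr0, expR0, expr0n)/=; lra.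
apply: (is_derive_le0_le (df := f1)) a0 _ d1 => y.
by apply: is_derive_eq; rewrite /GRing.scale/= /f1; field.
Qed.

(** * Counting renumberings and arcs *)

Lemma card_perm_le n : (#|'S_n| <= n ^ n)%N.
Proof.
rewrite -[X in (_ <= X ^ _)%N]card_ord -[X in (_ <= _ ^ X)%N]card_ord.
by rewrite -card_ffun -(card_imset _ (@val_inj _ _ _)) max_card.
Qed.

Lemma sum_arcs (V : nmodType) n (G : digraph n) (s : 'S_n) (x y : V) :
  \sum_(a in G) (if (s (val a).1 < s (val a).2)%N then x else y) =
  x *+ feedforward G s + y *+ feedback G s.
Proof.
pose ff (a : {a : 'I_n * 'I_n | a.1 != a.2}) := (s (val a).1 < s (val a).2)%N.
rewrite (bigID ff)/= /ff.
congr (_ + _).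
  rewrite (eq_bigr (fun=> x)) => [|a /andP[_ ->]//].
  by rewrite big_const iter_addr addr0; congr (_ *+ _).
rewrite (eq_bigr (fun=> y)) => [|a /andP[_ /negbTE->]//].
rewrite big_const iter_addr addr0; congr (_ *+ _).
apply: eq_card => a; rewrite !inE.
have : s (val a).1 != s (val a).2 :> nat.
  by rewrite (inj_eq val_inj) (inj_eq perm_inj) (valP a).
by rewrite unfold_in; case: ltngtP; rewrite ?andbT ?andbF.
Qed.

Lemma card_arcs n : #|{: {a : 'I_n * 'I_n | a.1 != a.2}}| = (n * n.-1)%N.
Proof.
rewrite card_sig.
have diagE : #|[pred a : 'I_n * 'I_n | a.1 == a.2]| = n.
  have diag_inj : injective (fun i : 'I_n => (i, i)) by move=> i j [].
  rewrite -[RHS](card_ord n) -(fintype.card_image diag_inj).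
  apply: eq_card => -[i j]; rewrite [LHS]inE.
  apply/idP/idP => [/eqP /= ->|/mapP[k _ [-> ->]]/=]; last exact: eqxx.
  exact: (map_f (fun i : 'I_n => (i, i)) (mem_enum _ j)).
have := cardC [pred a : 'I_n * 'I_n | a.1 == a.2].
rewrite diagE card_prod card_ord => h.
rewrite -subn1 mulnBr muln1 -h addKn.
by apply: eq_card => a; rewrite !inE.
Qed.

(** Reversing arcs is an involution that swaps the two kinds. *)
Lemma feedforward_setT n (s : 'S_n) :
  feedforward [set: _]%SET s = feedback [set: _]%SET s.
Proof.
have flipP (a : {a : 'I_n * 'I_n | a.1 != a.2}) :
    ((val a).2, (val a).1).1 != ((val a).2, (val a).1).2.
  by rewrite /= eq_sym (valP a).
pose flip a : {a : 'I_n * 'I_n | a.1 != a.2} :=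
  exist (fun b : 'I_n * 'I_n => b.1 != b.2) _ (flipP a).
have flipK : involutive flip.
  by move=> a; apply: val_inj; case: a => -[].
rewrite /feedforward /feedback -!sum1_card (reindex_inj (inv_inj flipK))/=.
by apply: eq_bigl => a; rewrite !inE.
Qed.

Lemma feedback_setT n (s : 'S_n) : (feedback [set: _]%SET s).*2 = (n * n.-1)%N.
Proof.
rewrite -addnn -{1}feedforward_setT feedforwardD cardsT; exact: card_arcs.
Qed.

(** * Chernoff and union bounds *)

(** The exponential is a product over arcs, so its expectation is exactly the product of 1 + p u(a)
    over all arcs; then 1 + x <= e^x applies to each factor. *)
Lemma chernoff_perm d (T : measurableType d) (R : realType)
    (P : probability T R) n (p : R) (D : T -> digraph n) (s : 'S_n)
    (r t : R) :
  0 <= p -> p <= 1 -> random_digraph P p D ->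
  \sum_(G : digraph n) law P D G *
     expR (t * ((feedforward G s)%:R - r * (feedback G s)%:R)) <=
  expR (p * (n%:R * n.-1%:R / 2) * (expR t + expR (- (r * t)) - 2)).
Proof.
move=> p0 p1 DP.
pose u (a : {a : 'I_n * 'I_n | a.1 != a.2}) :=
  if (s (val a).1 < s (val a).2)%N then expR t - 1 else expR (- (r * t)) - 1.
have uE (G : digraph n) :
    expR (t * ((feedforward G s)%:R - r * (feedback G s)%:R)) =
    \prod_(a in G) (1 + u a).
  transitivity (\prod_(a in G)
      expR (if (s (val a).1 < s (val a).2)%N then t else - (r * t))).
    rewrite -expR_sum; congr expR.
    by rewrite sum_arcs -(mulr_natr t) -(mulr_natr (- _)); ring.
  by apply: eq_bigr => a _; rewrite /u; case: ifP => _; ring.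
under eq_bigr do rewrite uE.
rewrite (sum_prod_superset _ (fun A => sum_law_superset A DP)).
have -> : p * (n%:R * n.-1%:R / 2) * (expR t + expR (- (r * t)) - 2) =
    \sum_a p * u a.
  rewrite -mulr_sumr -mulrA; congr (_ * _).
  transitivity (\sum_(a in [set: {a : 'I_n * 'I_n | a.1 != a.2}]%SET) u a);
    last first.
    by apply: eq_bigl => a; rewrite inE.
  rewrite sum_arcs feedforward_setT -mulrnDl -natrM -(feedback_setT s).
  by rewrite -mul2n natrM -mulr_natr; field.
rewrite expR_sum; apply: ler_prod => a _; rewrite expR_ge1Dx andbT.
(* Multiplying the inequalities needs 1 + p u(a) >= 0; it equals (1 - p) + p (u(a) + 1). *)
have u1 : 0 <= u a + 1 by rewrite /u; case: ifP => _; rewrite subrK expR_ge0.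
have := mulr_ge0 p0 u1; rewrite mulrDr mulr1; move: p1; lra.
Qed.

(** Markov's inequality as a finite sum against [law]: on the event, the term of [fas G] alone makes
    the sum of exponentials over all [s] at least 1. *)
Lemma ratio_tail d (T : measurableType d) (R : realType)
    (P : probability T R) n (p : R) (D : T -> digraph n) (r t : R) :
  0 <= p -> p <= 1 -> random_digraph P p D -> 0 <= t ->
  (P [set w | ratio_ge (Xstar (D w)) (Ystar (D w)) r] <=
   (n%:R ^+ n * expR (p * (n%:R * n.-1%:R / 2) *
                      (expR t + expR (- (r * t)) - 2)))%:E)%E.
Proof.
move=> p0 p1 DP t0.
have mD G : measurable (D @^-1` [set G]).
  by case: DP => mD _ _; exact: measurable_random_digraph.
rewrite (probability_law P (fun G => ratio_ge (Xstar G) (Ystar G) r) mD).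
rewrite lee_fin.
set M := expR (p * _ * _).
apply: (@le_trans _ _ (\sum_(s : 'S_n) M)); last first.
  rewrite sumr_const -[leLHS]mulr_natl ler_wpM2r ?expR_ge0// -natrX ler_nat.
  exact: card_perm_le.
pose e (G : digraph n) s :=
  expR (t * ((feedforward G s)%:R - r * (feedback G s)%:R)).
apply: (@le_trans _ _ (\sum_(G : digraph n) law P D G * \sum_s e G s));
    last first.
  under eq_bigr do rewrite mulr_sumr.
  by rewrite exchange_big/=; apply: ler_sum => s _; exact: chernoff_perm.
rewrite big_mkcond; apply: ler_sum => G _.
have e0 : 0 <= \sum_s e G s by apply: sumr_ge0 => s _; exact: expR_ge0.
case: ifPn => [rG|_]; last by rewrite mulr_ge0// law_ge0.
rewrite ler_peMr ?law_ge0// (bigD1 (fas G))//= ler_wpDr//.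
  by apply: sumr_ge0 => s _; exact: expR_ge0.
rewrite -expR0 ler_expR mulr_ge0// subr_ge0.
(* When Y = 0 the exponent is t X >= 0, in accord with the convention. *)
move: rG; rewrite /ratio_ge /Xstar /Ystar; case: eqP => [->|/eqP Y0]/=.
  by rewrite mulr0.
by rewrite ler_pdivlMr// ltr0n lt0n.
Qed.

(** * Estimates for the chosen parameters *)

Lemma chernoff_exponent_le (R : realType) (eps : R) : 0 < eps ->
  expR (eps / (1 + (1 + eps) ^+ 2))
    + expR (- ((1 + eps) * (eps / (1 + (1 + eps) ^+ 2)))) - 2 <=
  - (eps ^+ 2 / (2 * (1 + (1 + eps) ^+ 2))).
Proof.
set r := 1 + eps; set t := eps / _; move=> e0.
have r1 : 1 <= r by rewrite /r; lra.
have q0 : 0 < 1 + r ^+ 2 by rewrite addr_gt0// exprn_gt0//; lra.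
have t0 : 0 <= t by rewrite divr_ge0 ?ltW.
have tq : t * (1 + r ^+ 2) = eps by rewrite /t divfK// gt_eqF.
apply: le_trans (expR_quadratic_bound r1 t0 _) _.
  rewrite -(ler_pM2r q0).
  have -> : (1 + r * t) * (1 + r ^+ 2) = 1 + r ^+ 2 + r * eps.
    by rewrite -tq; ring.
  have -> : r ^+ 3 * (1 - t) * (1 + r ^+ 2) = r ^+ 3 * (1 + r ^+ 2 - eps).
    by rewrite -tq; ring.
  (* As eps = r - 1, the slack in the side condition, times 1 + r^2, is eps (1 + r^2)^2. *)
  rewrite -subr_ge0 (_ : _ - _ = eps * (r ^+ 4 + 2 * r ^+ 2 + 1)); last first.
    by rewrite /r; ring.
  apply: mulr_ge0; first exact: ltW.
  by have := sqr_ge0 r; have := sqr_ge0 (r ^+ 2); lra.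
rewrite le_eqVlt; apply/orP; left; apply/eqP; rewrite /t /r; field.
by rewrite gt_eqF.
Qed.

(** With L = log n >= 2C, one has n = e^L >= L^2 / 2 >= C L. *)
Lemma arc_prob_le1 (R : realType) (C : R) (n : nat) :
  0 < C -> expR (2 * C) <= n%:R -> arc_prob C n <= 1.
Proof.
move=> C0 Cn; have n0 : 0 < n%:R :> R by exact: lt_le_trans (expR_gt0 _) Cn.
have lnC : 2 * C <= ln n%:R by rewrite -ler_expR lnK.
have := expR_ge1Dxn 1 (le_trans (mulr_ge0 (ler0n R 2) (ltW C0)) lnC).
rewrite lnK// (_ : 2`! = 2)%N// => h.
rewrite /arc_prob mulrA ler_pdivrMr// mul1r.
have : 0 <= ln n%:R * (ln n%:R - 2 * C).
  by rewrite mulr_ge0 ?subr_ge0// (le_trans _ lnC)// mulr_ge0// ltW.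
by move: h; rewrite expr2; lra.
Qed.

(** With L = log n >= 0, taking logarithms reduces this to n L - k L (n - 1) <= - L, which follows
    from n + 1 <= k (n - 1); the threshold on n is this inequality solved for n. *)
Lemma union_bound_le_inv (R : realType) (k : R) (n : nat) :
  1 < k -> (k + 1) / (k - 1) <= n%:R ->
  n%:R ^+ n * expR (- (k * (ln n%:R * (n%:R - 1)))) <= n%:R^-1.
Proof.
move=> k1; rewrite ler_pdivrMr ?subr_gt0// => nk.
have n0 : 0 < n%:R :> R.
  by rewrite -(pmulr_lgt0 _ (x := k - 1)) ?subr_gt0//; lra.
rewrite -[X in X ^+ n](lnK (n0 : n%:R \is Num.pos)) -expRM_natl -expRD.
rewrite -[leRHS](lnK (x := n%:R^-1)) ?posrE ?invr_gt0// lnV ?posrE// ler_expR.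
have : 0 <= ln (n%:R : R) by rewrite ln_ge0// ler1n -(ltr0n R).
nra.
Qed.

(* For small n, C log n / n may exceed 1; D n is constrained only for those n
   (all but finitely many) for which it is a probability. *)
Theorem theorem4p2 (R : realType) (eps C : R)
  (d : nat -> measure_display) (T : forall n, measurableType (d n))
  (P : forall n, probability (T n) R) (D : forall n, T n -> digraph n) :
  0 < eps -> 0 < C ->
  1 < C * (eps ^+ 2 / (4 * (1 + (1 + eps) ^+ 2))) ->
  (forall n, arc_prob C n <= 1 -> random_digraph (P n) (arc_prob C n) (@D n)) ->
  P n [set w | ratio_ge (Xstar (D n w)) (Ystar (D n w)) (1 + eps)]
    @[n --> \oo] --> 0%E.
Proof.
move=> e0 C0; set k := C * _ => k1 DP.
have q0 : 0 < 1 + (1 + eps) ^+ 2.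
  by rewrite addr_gt0// exprn_gt0// addr_gt0.
apply: (@squeeze_cvge _ _ _ _ (cst 0%E) _ (fun n => (n%:R^-1)%:E));
  last 2 first.
- exact: cvg_cst.
- by rewrite -cvg_shiftS; exact: cvge_harmonic.
have p1 : \forall n \near \oo, arc_prob C n <= 1.
  by near=> n; apply: arc_prob_le1 => //; near: n; exact: nbhs_infty_ger.
near=> n; rewrite measure_ge0/=.
have n1 : (0 < n)%N by near: n; exact: nbhs_infty_gt.
have p0 : 0 <= arc_prob C n.
  by rewrite mulr_ge0 ?divr_ge0 ?ln_ge0 ?ler1n// ltW.
have p1n : arc_prob C n <= 1 by near: n.
pose t := eps / (1 + (1 + eps) ^+ 2).
apply: le_trans (ratio_tail (t := t) (1 + eps) p0 p1n (DP n p1n) _) _.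
  by rewrite divr_ge0 ?ltW.
rewrite lee_fin; apply: le_trans (union_bound_le_inv k1 _); last first.
  near: n; exact: nbhs_infty_ger.
rewrite ler_wpM2l ?exprn_ge0// ler_expR.
apply: le_trans (ler_wpM2l _ (chernoff_exponent_le e0)) _.
  by rewrite mulr_ge0// divr_ge0// mulr_ge0.
(* Equality holds: n cancels, and the halves from n(n-1)/2 and from the exponent give the 4 in
   [k]. *)
rewrite le_eqVlt; apply/orP; left; apply/eqP; rewrite /arc_prob /k.
rewrite -subn1 natrB//; field.
by rewrite !gt_eqF// ltr0n.
Unshelve. all: by end_near.
Qed.
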